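(* Let $N\ge 1$, $\mathcal I=\{1,\dots,N\}$, and consider the system $$\dot x_i=\sum_{j\in\mathcal I}s(x_j-x_i)(x_j-x_i),\qquad i\in\mathcal I,\qquad (\ast)$$ where $s:\mathbb R\to\mathbb R$ is given by $s(\tau)=1$ if $|\tau|<1$ and $s(\tau)=0$ if $|\tau|\ge 1$. The set of Krasovskii equilibria of $(\ast)$ is $$F=\left\{x\in\mathbb R^N:\ \text{for every }(i,j)\in\mathcal I\times\mathcal I,\ \text{either } x_i=x_j\ \text{or}\ |x_i-x_j|\ge 1\right\},$$ and if $x(\cdot)$ is a (complete) Krasovskii solution to $(\ast)$, then $x(t)$ converges to a point $x_*\in F$ as $t\to+\infty$.
   Context: $\overline{\mathrm{co}}(A)$ denotes the closed convex hull of a set $A$. For $g:\mathbb R^N\to\mathbb R^N$ (possibly discontinuous), a Krasovskii solution of $\dot x=g(x)$ on an interval $I\subset\mathbb R$ is an absolutely continuous map $\phi:I\to\mathbb R^N$ with $\dot\phi(t)\in\mathcal K g(\phi(t))$ for almost every $t\in I$, where $$\mathcal K g(x)=\bigcap_{\delta>0}\overline{\mathrm{co}}\left(\{g(y):\|x-y\|<\delta\}\right).$$ A solution is complete if it is defined for all $t\ge 0$; every Krasovskii solution of $(\ast)$ can be extended to a complete one. A point $\tilde x\in\mathbb R^N$ is a Krasovskii equilibrium if the constant function $x(t)\equiv\tilde x$ is a Krasovskii solution, i.e. $0\in\mathcal K g(\tilde x)$. *)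

(* Defs.v *)
From HB Require Import structures.
From mathcomp Require Import all_boot all_order all_algebra.
From mathcomp Require Import all_classical all_reals all_analysis.

Set Implicit Arguments.
Unset Strict Implicit.
Unset Printing Implicit Defensive.

Import Order.TTheory GRing.Theory Num.Theory.
Import numFieldNormedType.Exports.

Local Open Scope classical_set_scope.
Local Open Scope ring_scope.

(* The library norm `|x| on 'rV[R]_N is the sup norm; the Euclidean one is not
   provided.  Both induce the library topology of 'rV[R]_N. *)
Definition enorm (R : realType) (N : nat) (x : 'rV[R]_N) : R :=
  Num.sqrt (\sum_(i < N) x 0 i ^+ 2).

Definition closed_convex_hull (R : realType) (N : nat) (A : set 'rV[R]_N) :
    set 'rV[R]_N :=
  closure (smallest (@convex_set R 'rV[R]_N) A).

Definition krasovskii (R : realType) (N : nat) (g : 'rV[R]_N -> 'rV[R]_N)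
    (x : 'rV[R]_N) : set 'rV[R]_N :=
  \bigcap_(delta in [set d : R | 0 < d])
    closed_convex_hull [set g y | y in [set y | enorm (x - y) < delta]].

Definition abs_continuous_on (R : realType) (N : nat) (a b : R)
    (f : R -> 'rV[R]_N) : Prop :=
  forall e : R, 0 < e -> exists2 d : R, 0 < d &
    forall (n : nat) (u v : 'I_n -> R),
      (forall k, a <= u k /\ u k <= v k /\ v k <= b) ->
      trivIset setT (fun k => [set` `]u k, v k[]) ->
      \sum_(k < n) (v k - u k) < d ->
      \sum_(k < n) enorm (f (v k) - f (u k)) < e.

(* On an interval that need not be compact, absolute continuity is required on
   every compact subinterval. *)
Definition abs_continuous (R : realType) (N : nat) (I : interval R)
    (f : R -> 'rV[R]_N) : Prop :=
  forall a b : R, [set` `[a, b]] `<=` [set` I] -> abs_continuous_on a b f.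

(* A solution on I is represented by a total function whose values outside I
   are irrelevant: the two-sided derivative is affected by them only at the
   endpoints of I, which form a null set. *)
Definition krasovskii_solution (R : realType) (N : nat)
    (g : 'rV[R]_N -> 'rV[R]_N) (I : interval R) (phi : R -> 'rV[R]_N) : Prop :=
  abs_continuous I phi /\
  {ae @lebesgue_measure R, forall t : R, t \in I ->
     derivable phi t 1 /\ krasovskii g (phi t) ('D_1 phi t)}.

Definition complete_krasovskii_solution (R : realType) (N : nat)
    (g : 'rV[R]_N -> 'rV[R]_N) (I : interval R) (phi : R -> 'rV[R]_N) : Prop :=
  (forall t : R, 0 <= t -> t \in I) /\ krasovskii_solution g I phi.

Definition krasovskii_equilibrium (R : realType) (N : nat)
    (g : 'rV[R]_N -> 'rV[R]_N) (x : 'rV[R]_N) : Prop :=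
  krasovskii_solution g `[0, +oo[ (fun=> x).

Definition influence (R : realType) (tau : R) : R :=
  if `|tau| < 1 then 1 else 0.

Definition opinion_field (R : realType) (N : nat) (x : 'rV[R]_N) : 'rV[R]_N :=
  \row_i \sum_(j < N) influence (x 0 j - x 0 i) * (x 0 j - x 0 i).

Definition clustered (R : realType) (N : nat) : set 'rV[R]_N :=
  [set x | forall i j : 'I_N, x 0 i = x 0 j \/ 1 <= `|x 0 i - x 0 j|].

(* Main.v *)
Require Import Defs.
From HB Require Import structures.
From mathcomp Require Import all_boot all_order all_algebra.
From mathcomp Require Import all_classical all_reals all_analysis.
From mathcomp Require Import ring lra.

Set Implicit Arguments.
Unset Strict Implicit.
Unset Printing Implicit Defensive.

Import Order.TTheory GRing.Theory Num.Theory.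
Import numFieldNormedType.Exports.

Local Open Scope classical_set_scope.
Local Open Scope ring_scope.

(** Why the theorem holds.

    The interaction is symmetric, so for every nondecreasing b : R -> R the sum
    of b(x_i) v_i over i is nonpositive for every Krasovskii velocity v at x:
    symmetrizing over pairs turns it into minus half the sum of the
    a_ij (x_j - x_i) (b(x_j) - b(x_i)), where a_ij = a_ji >= 0.  More precisely
    (krasovskii_comonotone), a linear functional whose weights are ordered like
    the coordinates of x is maximal over the Krasovskii set at the value of the
    field at x itself.  This only needs closed half-spaces, never an explicit
    description of the convex hull.

    Hence the energy V = sum of the x_i^2 does not increase.  If f is
    differentiable with a Lipschitz derivative, then K z^2 + f and K z^2 - f
    have nondecreasing derivatives for K large, so the variation of the sum of
    the f(x_i) between two times is at most K times the loss of V
    (variation_le_energy_drop).  Since V converges, so does the sum of the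
    f(x_i), for every such f.

    This forces each coordinate to converge (coordinate_cvg). Otherwise some
    x_i crosses a fixed interval ]p, q[ infinitely often. Take N + 1 bumps f
    that vanish outside disjoint open subintervals of ]p, q[. Arbitrarily
    late, x_i visits the peak of each bump, where the sum of the f(x_j) is at
    least the height of the bump; since these sums hardly vary at late times,
    at one single late time all N + 1 sums are positive. The N + 1 disjoint
    subintervals then contain N + 1 different coordinates among N, which is
    absurd.

    If two limit coordinates differed by less than 1 without being equal, V
    would eventually decrease at a rate bounded away from 0 and become negative
    (limit_clustered).  The same dissipation estimate, at velocity 0, gives the
    equilibria.

    To pass from almost every time to all times, one needs that an absolutely
    continuous function with derivative at most c almost everywhere grows at
    rate at most c (abs_continuous_growth).  It is proved by cutting the time
    interval into finitely many steps on which either the increment is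
    controlled by the derivative, or the whole step lies in a small open
    neighbourhood of the exceptional null set. *)

(** * Krasovskii velocities of the opinion field *)

Lemma enorm_coord (R : realType) (N : nat) (x : 'rV[R]_N) i :
  `|x 0 i| <= enorm x.
Proof.
rewrite -sqrtr_sqr ler_wsqrtr// (bigD1 i)//= lerDl.
by apply: sumr_ge0 => j _; exact: sqr_ge0.
Qed.

Lemma closed_convex_hull_le (R : realType) (N : nat) (w : 'I_N -> R)
    (A : set 'rV[R]_N) (c : R) :
  (forall y, A y -> \sum_i w i * y 0 i <= c) ->
  forall v, closed_convex_hull A v -> \sum_i w i * v 0 i <= c.
Proof.
move=> Ac; pose H := [set v : 'rV[R]_N | \sum_i w i * v 0 i <= c].
suff clH : closed_convex_hull A `<=` H by [].
have cf : continuous (fun v : 'rV[R]_N => \sum_i w i * v 0 i).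
  move=> v; apply: (@cvg_big R 'I_N +%R 0 predT add_continuous _ (nbhs v)) => i _.
  by apply: cvgM; [exact: cvg_cst | exact: coord_continuous].
have cH : closed H.
  by apply: (preimage_closed _ (@closed_le R c)) => v _; exact: cf.
rewrite (iffLR (closure_id _) cH); apply: closureS.
apply: smallest_sub => // u v l; rewrite !inE => Hu Hv.
rewrite /H /=.
under eq_bigr do rewrite !mxE mulrDr !(mulrCA (w _)).
rewrite big_split/= -!mulr_sumr.
have l0 : 0 <= l%:num by [].
have l1 : l%:num <= 1 by [].
rewrite [leRHS](_ : c = l%:num * c + unstable.onem l%:num * c); last first.
  by rewrite /unstable.onem; ring.
by apply: lerD; apply: ler_wpM2l => //; rewrite subr_ge0.
Qed.

(** Summation by parts, from the symmetry of the influence in (i, j). *)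
Lemma opinion_field_weighted (R : realType) (N : nat) (w : 'I_N -> R)
    (y : 'rV[R]_N) :
  (\sum_i w i * opinion_field y 0 i) *+ 2 =
  - \sum_i \sum_j influence (y 0 j - y 0 i) *
      ((y 0 j - y 0 i) * (w j - w i)).
Proof.
pose T i j := w i * (influence (y 0 j - y 0 i) * (y 0 j - y 0 i)).
have infC i j : influence (y 0 j - y 0 i) = influence (y 0 i - y 0 j).
  by rewrite /influence distrC.
transitivity (\sum_i \sum_j T i j + \sum_i \sum_j T j i).
  rewrite [X in _ + X]exchange_big/= -mulr2n; congr (_ *+ 2).
  by apply: eq_bigr => i _; rewrite mxE mulr_sumr.
rewrite -big_split -sumrN; apply: eq_bigr => i _.
rewrite -big_split -sumrN; apply: eq_bigr => j _.
by rewrite /T (infC j i)/=; ring.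
Qed.

(** At a point y near x, the pairs with |x_j - x_i| < 1 still interact.  A pair
    at distance 1 or more may interact at y but not at x: by comonotonicity its
    contribution to the weighted sum at y is at most of the order of |x - y|.
    So the weighted sum at y exceeds the one at x by at most a term that
    vanishes as y tends to x, and this bound passes to the closed convex hull. *)
Lemma krasovskii_comonotone (R : realType) (N : nat) (w : 'I_N -> R)
    (x v : 'rV[R]_N) :
  (forall i j, 0 <= (x 0 j - x 0 i) * (w j - w i)) ->
  krasovskii (@opinion_field R N) x v ->
  \sum_i w i * v 0 i <= \sum_i w i * opinion_field x 0 i.
Proof.
move=> wx Kv; apply/ler_addgt0Pr => e e0.
pose C := \sum_i \sum_j `|w j - w i|.
have C0 : 0 <= C by apply: sumr_ge0 => i _; exact: sumr_ge0.
have [d [d0 gap dC]] : exists d : R, [/\ 0 < d,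
    (forall i j, `|x 0 j - x 0 i| < 1 -> 2 * d <= 1 - `|x 0 j - x 0 i|) &
    d * C <= e].
  apply/(@filter_ex _ (0:R)^'+); near=> d; split.
  - by near: d; exact: nbhs_right_gt.
  - near: d; apply: filter_forall => i; apply: filter_forall => j.
    have [ij|ij] := ltP `|x 0 j - x 0 i| 1; last by near=> d.
    near=> d => _; rewrite mulrC -ler_pdivlMr//.
    by near: d; apply: nbhs_right_le; rewrite divr_gt0// subr_gt0.
  - rewrite (@le_trans _ _ (d * (C + 1)))// ?ler_wpM2l ?lerDl//.
    rewrite -ler_pdivlMr ?ltr_wpDl//.
    by near: d; apply: nbhs_right_le; rewrite divr_gt0// ltr_wpDl.
have := Kv d d0; apply: closed_convex_hull_le => _ [y xy <-].
rewrite -(@ler_pM2r _ 2)// [leRHS]mulrDl !mulr_natr !opinion_field_weighted.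
have term i j : influence (x 0 j - x 0 i) * ((x 0 j - x 0 i) * (w j - w i)) -
    d * `|w j - w i| *+ 2 <=
    influence (y 0 j - y 0 i) * ((y 0 j - y 0 i) * (w j - w i)).
  have yx k : `|x 0 k - y 0 k| < d.
    by apply: le_lt_trans xy; have := enorm_coord (x - y) k; rewrite !mxE.
  have dev : (x 0 j - x 0 i) * (w j - w i) - d * `|w j - w i| *+ 2 <=
      (y 0 j - y 0 i) * (w j - w i).
    rewrite lerBlDr -lerBlDl -mulrBl (le_trans (ler_norm _))// normrM.
    rewrite -mulrnAl ler_wpM2r//.
    move: (yx i) (yx j); rewrite !ltr_norml ler_norml => /andP[? ?] /andP[? ?].
    by apply/andP; split; lra.
  rewrite {1}/influence; case: ifPn => [close|_].
    rewrite mul1r {1}/influence ifT ?mul1r//.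
    move: (gap i j close) (yx i) (yx j); case/ltr_normlP: close => ? ?.
    have [? ?|? ?] := ger0P (x 0 j - x 0 i);
      by rewrite !ltr_norml => /andP[? ?] /andP[? ?]; apply/andP; split; lra.
  rewrite mul0r {1}/influence; case: ifPn => _.
    by rewrite mul1r (le_trans _ dev)// lerB// wx.
  by rewrite mul0r sub0r oppr_le0 mulrn_wge0// mulr_ge0// ltW.
have : \sum_i \sum_j (influence (x 0 j - x 0 i) * ((x 0 j - x 0 i) * (w j - w i)) -
    d * `|w j - w i| *+ 2) <=
    \sum_i \sum_j influence (y 0 j - y 0 i) * ((y 0 j - y 0 i) * (w j - w i)).
  by apply: ler_sum => i _; apply: ler_sum.
under eq_bigr do rewrite sumrB.
rewrite sumrB.
have -> : \sum_i \sum_j d * `|w j - w i| *+ 2 = d * C *+ 2.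
  rewrite /C mulr_sumr -sumrMnl; apply: eq_bigr => i _.
  by rewrite mulr_sumr -sumrMnl.
by move: dC; move: (\sum_i _) (\sum_i _) => S T; lra.
Unshelve. all: by end_near. Qed.

(** * Growth of absolutely continuous functions *)

(** A local condition gives a finite chain (Cousin's lemma): the supremum of the
    points that can be reached from a is itself reached, and cannot lie before b.
    The sequence tau is made constant after its n-th term, so that consecutive
    terms are related at every index. *)
Lemma cousin_chain (R : realType) (S : R -> R -> Prop) (a b : R) : a <= b ->
  (forall t, a <= t <= b -> exists2 d : R, 0 < d &
    forall s, a <= s <= b ->
      (t - d < s <= t -> S s t) /\ (t <= s < t + d -> S t s)) ->
  exists (tau : nat -> R) (n : nat),
    [/\ tau 0%N = a, tau n = b & forall k, S (tau k) (tau k.+1)].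
Proof.
move=> ab locS.
pose reach t := exists (tau : nat -> R) (n : nat),
  [/\ tau 0%N = a, tau n = t & forall k, S (tau k) (tau k.+1)].
have refl t : a <= t <= b -> S t t.
  move=> tab; have [d d0 /(_ t tab)[+ _]] := locS t tab.
  by apply; rewrite lexx ltrBlDr ltrDl d0.
have step s t : reach s -> S s t -> S t t -> reach t.
  move=> [tau [n [tau0 taun Stau]]] Sst Stt.
  exists (fun k => if (k <= n)%N then tau k else t), n.+1.
  rewrite leq0n ltnn; split=> // k.
  have [kn|kn|->] := ltngtP k n; last by rewrite taun.
    by rewrite ?(ltnW kn); exact: Stau.
  by [].
pose A := [set t | a <= t <= b /\ reach t].
have Aa : A a.
  rewrite /A/= lexx ab; split=> //; exists (fun=> a), 0%N; split=> // _.
  by apply: refl; rewrite lexx.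
have ubA : has_ubound A by exists b => t [/andP[]].
have supab : a <= sup A <= b.
  by rewrite ub_le_sup// ge_sup//; [exists a | move=> t [/andP[]]].
have [d d0 Sd] := locS _ supab.
have [t [tab rt] tsup] : exists2 t, A t & sup A - d < t.
  by apply: sup_adherent => //; split=> //; exists a.
have rsup : reach (sup A).
  apply: (step _ _ rt) (refl _ supab); apply: (Sd t tab).1.
  by rewrite tsup (ub_le_sup ubA (conj tab rt)).
have [supb|supb] := ltP (sup A) b; last first.
  by rewrite (_ : b = sup A)//; apply/eqP; rewrite eq_le supb; case/andP: supab.
pose s := Num.min b (sup A + d / 2).
have sups : sup A < s by rewrite lt_min supb ltrDl divr_gt0.
have sab : a <= s <= b.
  case/andP: supab => asup _.
  by rewrite ge_min lexx/= andbT (le_trans asup)// ltW.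
have : A s.
  split=> //; apply: (step _ _ rsup) (refl _ sab); apply: (Sd s sab).2.
  rewrite (ltW sups)/= gt_min; apply/orP; right.
  by rewrite ltrD2l gtr_pMr// invf_lt1// ltr1n.
by move=> /(ub_le_sup ubA); rewrite leNgt sups.
Qed.

(** The intervals ]tau k, v k[ may be empty (v k = tau k); this is how the steps
    to be discarded in a chain are left out of the sum. *)
Lemma sum_itv_length_le (R : realType) (tau v : nat -> R) (n : nat) (U : set R) :
  (forall k, tau k <= v k <= tau k.+1) -> measurable U ->
  (forall k, [set` `]tau k, v k[] `<=` U) ->
  trivIset setT (fun k => [set` `]tau k, v k[]) /\
  ((\sum_(k < n) (v k - tau k))%:E <= @lebesgue_measure R U)%E.
Proof.
move=> tauv mU vU.
have tau_mono : nondecreasing_seq tau.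
  apply/nondecreasing_seqP => k.
  by case/andP: (tauv k); exact: le_trans.
have triv : trivIset setT (fun k => [set` `]tau k, v k[]).
  apply: ltn_trivIset => k m mk; rewrite -subset0 => t [] /=.
  rewrite !in_itv/= => /andP[_ tv] /andP[vt _].
  have := lt_trans vt tv; rewrite ltNge (le_trans _ (tau_mono _ _ mk))//.
  by case/andP: (tauv m).
split=> //.
have -> : (\sum_(k < n) (v k - tau k))%:E =
    lebesgue_measure (\big[setU/set0]_(k < n) [set` `]tau k, v k[]).
  rewrite (@measure_bigsetU _ _ _ (@lebesgue_measure R)
    (fun k => [set` `]tau k, v k[]))//.
  rewrite -sumEFin; apply: eq_bigr => k _; rewrite /= lebesgue_measure_itv/= lte_fin.
  have [_|vt] := ltP (tau k) (v k); first by rewrite EFinB.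
  by congr EFin; apply/eqP; rewrite subr_eq0 eq_le vt; case/andP: (tauv k).
apply: le_measure; rewrite ?inE//; first exact: bigsetU_measurable.
by elim/big_ind: _ => // A B; rewrite subUset.
Qed.

Definition abs_continuous_real (R : realType) (a b : R) (f : R -> R) : Prop :=
  forall e : R, 0 < e -> exists2 d : R, 0 < d &
    forall (n : nat) (u v : 'I_n -> R),
      (forall k, a <= u k /\ u k <= v k /\ v k <= b) ->
      trivIset setT (fun k => [set` `]u k, v k[]) ->
      \sum_(k < n) (v k - u k) < d ->
      \sum_(k < n) `|f (v k) - f (u k)| < e.

Lemma is_derive_increment (R : realType) (f : R -> R) (t l : R) :
  is_derive t 1 f l -> forall e : R, 0 < e -> exists2 d : R, 0 < d &
  forall s, `|s - t| < d -> `|f s - f t - l * (s - t)| <= e * `|s - t|.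
Proof.
move=> [dft <-] e e0; move/cvgrPdist_le : dft => /(_ _ e0)[d /= d0 fd].
exists d => // s std; have [->|st] := eqVneq s t.
  by rewrite !subrr mulr0 subr0 normr0 mulr0.
have st0 : s - t != 0 by rewrite subr_eq0.
have := fd (s - t); rewrite /= sub0r normrN => /(_ std st0).
rewrite [_ *: 1](mulr1) subrK -/('D_1 f t) => fst.
rewrite -ler_pdivrMr ?normr_gt0// -normfV -normrM.
rewrite mulrBl mulfK// mulrC distrC.
exact: fst.
Qed.

(** Cover the exceptional null set by an open U of small measure.  Every t
    either lies in U, or the derivative controls the increments near t up to a
    slope e, so a Cousin chain joins a to b by steps that are good or contained
    in U.  The good steps telescope to at most (c + e) (b - a); the other ones
    have small total length, hence by absolute continuity a small total
    increment. *)
Lemma abs_continuous_growth (R : realType) (f : R -> R) (a b c : R) :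
  a <= b -> abs_continuous_real a b f ->
  {ae @lebesgue_measure R, forall t : R, t \in `[a, b] ->
     exists2 l, l <= c & is_derive t 1 f l} ->
  f b - f a <= c * (b - a).
Proof.
move=> ab acf [M [mM M0 badM]].
suff slack (e : R) : 0 < e -> f b - f a <= c * (b - a) + e * (b - a + 2).
  apply/ler_addgt0Pr => e e0; have ba2 : 0 < b - a + 2 by lra.
  by have := slack (e / (b - a + 2)); rewrite divfK ?gt_eqF// divr_gt0//; apply.
move=> e0; have [d d0 acd] := acf e e0.
have ce0 : 0 < `|c + e| + 1 by rewrite ltr_wpDl.
(* The second bound is used when c + e < 0: the steps inside U then miss a
   negative contribution, of size at most |c + e| times their length. *)
pose r := Num.min d (e / (`|c + e| + 1)).
have r0 : 0 < r by rewrite lt_min d0 divr_gt0.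
have [U [oU MU Ur]] : exists U : set R,
    [/\ open U, M `<=` U & (lebesgue_measure (U `\` M) < r%:E)%E].
  by apply: lebesgue_regularity_outer => //; rewrite [ltLHS]M0.
have mU : measurable U by exact: measurable_realfun.open_measurable.
have {}Ur : (lebesgue_measure U < r%:E)%E.
  apply: le_lt_trans Ur; rewrite -[leRHS]add0e -[X in (_ <= X + _)%E]M0.
  rewrite -[X in (lebesgue_measure X <= _)%E](setDUK MU).
  by apply: measureU2 => //; exact: measurableD.
pose good s t := f t - f s <= (c + e) * (t - s).
pose S s t := a <= s <= t /\ t <= b /\ (good s t \/ [set` `[s, t]] `<=` U).
have [tau [n [tau0 taun Stau]]] : exists (tau : nat -> R) (n : nat),
    [/\ tau 0%N = a, tau n = b & forall k, S (tau k) (tau k.+1)].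
  apply: cousin_chain => // t /andP[a_t tb].
  have [Ut|nUt] := pselect (U t).
    have [d' /= d'0 dU] : \forall x \near t, U x by exact: open_nbhs_nbhs.
    exists d' => // s /andP[as_ sb]; split=> /andP[st ts].
      split; first by rewrite as_.
      split=> //; right => x /=; rewrite in_itv/= => /andP[? ?].
      by apply: dU; rewrite /ball/= ger0_norm; lra.
    split; first by rewrite a_t.
    split=> //; right => x /=; rewrite in_itv/= => /andP[? ?].
    by apply: dU; rewrite /ball/= ler0_norm; lra.
  have [l lc fl] : exists2 l, l <= c & is_derive t 1 f l.
    apply: contrapT => bad; apply: nUt; apply: MU; apply: badM => /= h.
    by apply: bad; apply: h; rewrite in_itv/= a_t.
  have [d' d'0 incr] := is_derive_increment fl e0.
  exists d' => // s /andP[as_ sb]; split=> /andP[st ts].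
    split; first by rewrite as_.
    split=> //; left; rewrite /good.
    have := incr s; rewrite ler0_norm; last lra.
    rewrite ler_norml => /(_ ltac:(lra))/andP[].
    have : 0 <= (c - l) * (t - s) by rewrite mulr_ge0 ?subr_ge0.
    lra.
  split; first by rewrite a_t.
  split=> //; left; rewrite /good.
  have := incr s; rewrite ger0_norm; last lra.
  rewrite ler_norml => /(_ ltac:(lra))/andP[].
  have : 0 <= (c - l) * (s - t) by rewrite mulr_ge0 ?subr_ge0.
  lra.
pose v k := if `[< good (tau k) (tau k.+1) >] then tau k else tau k.+1.
have tauv k : tau k <= v k <= tau k.+1.
  have [/andP[_ tt] _] := Stau k.
  by rewrite /v; case: ifP => _; rewrite lexx ?tt ?andbT.
have [|triv len] := @sum_itv_length_le R tau v n U tauv mU.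
  move=> k; rewrite /v; case: asboolP => [_|ngood].
    by rewrite set_itvE.
  have [_ [_ []//]] := Stau k.
  by apply: subset_trans; exact: subset_itv_oo_cc.
have len_r : \sum_(k < n) (v k - tau k) < r.
  by rewrite -lte_fin; exact: le_lt_trans len Ur.
have var_e : \sum_(k < n) `|f (v k) - f (tau k)| < e.
  apply: (acd n (fun k => tau k) (fun k => v k)).
  - move=> k; have [/andP[at_ _] [tb _]] := Stau k.
    by have /andP[tv vt] := tauv k; rewrite at_ tv (le_trans vt).
  - apply/trivIsetP => i j _ _ ij.
    by move/trivIsetP: triv; apply.
  - by rewrite (lt_le_trans len_r)// ge_min lexx.
have -> : f b - f a = \sum_(k < n) (f (tau k.+1) - f (tau k)).
  by rewrite -(big_mkord predT (fun k => f (tau k.+1) - f (tau k)))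
    (telescope_sumr (f \o tau))//= taun tau0.
have -> : b - a = \sum_(k < n) (tau k.+1 - tau k).
  by rewrite -(big_mkord predT (fun k => tau k.+1 - tau k)) telescope_sumr//
    taun tau0.
have step k : f (tau k.+1) - f (tau k) <= (c + e) * (tau k.+1 - tau k) +
    `|c + e| * (v k - tau k) + `|f (v k) - f (tau k)|.
  rewrite /v; case: asboolP => [gk|_].
    by rewrite !subrr mulr0 normr0 !addr0.
  have [/andP[_ tt] _] := Stau k.
  have := ler_norm (f (tau k.+1) - f (tau k)).
  have : 0 <= (`|c + e| + (c + e)) * (tau k.+1 - tau k).
    by rewrite mulr_ge0 ?subr_ge0// -lerBlDr sub0r -normrN ler_norm.
  lra.
apply: (@le_trans _ _ (\sum_(k < n) ((c + e) * (tau k.+1 - tau k) +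
    `|c + e| * (v k - tau k) + `|f (v k) - f (tau k)|))).
  by apply: ler_sum => k _.
rewrite [leLHS]big_split/= [X in X + _]big_split/= -!mulr_sumr.
have : `|c + e| * \sum_(k < n) (v k - tau k) <= e.
  apply: (@le_trans _ _ (`|c + e| * (e / (`|c + e| + 1)))).
    by rewrite ler_wpM2l// ltW// (lt_le_trans len_r)// ge_min lexx orbT.
  by rewrite mulrCA ger_pMr// ler_pdivrMr// mul1r lerDl.
move: var_e; move: (\sum_(k < n) (tau k.+1 - tau k)) (\sum_(k < n) (v k - tau k)).
by move: (\sum_(k < n) `|_|) => W D L; lra.
Qed.

(** * Sums of a function of the coordinates along a solution *)

Lemma abs_continuous_within (R : realType) (N : nat) (a b : R)
    (x : R -> 'rV[R]_N) (i : 'I_N) :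
  abs_continuous_on a b x -> {within `[a, b], continuous (fun t => x t 0 i)}.
Proof.
move=> acx; apply/subspace_continuousP => t /=; rewrite in_itv/= => /andP[a_t tb].
apply/cvgrPdist_lt => e e0; have [d d0 acd] := acx e e0.
have small u v : a <= u -> u <= v -> v <= b -> v - u < d ->
    `|x v 0 i - x u 0 i| < e.
  move=> au uv vb vud.
  have := acd 1%N (fun=> u) (fun=> v) (fun=> conj au (conj uv vb)).
  rewrite !big_ord1 => /(_ _ vud) h; apply: le_lt_trans (h _).
    by have := enorm_coord (x v - x u) i; rewrite !mxE.
  by apply/trivIsetP => j k _ _; rewrite !ord1 eqxx.
rewrite near_withinE; exists d => // s; rewrite /= in_itv/= => tsd /andP[as_ sb].
have [ts|st] := leP t s.
  rewrite distrC; apply: small => //; apply: le_lt_trans tsd.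
  by rewrite distrC ler_norm.
apply: small => //; first exact: ltW.
by apply: le_lt_trans tsd; rewrite ler_norm.
Qed.

Lemma abs_continuous_bounded (R : realType) (N : nat) (a b : R)
    (x : R -> 'rV[R]_N) : a <= b -> abs_continuous_on a b x ->
  exists M : R, forall t i, t \in `[a, b] -> `|x t 0 i| <= M.
Proof.
move=> ab acx.
have bnd i : exists M : R, forall t, t \in `[a, b] -> `|x t 0 i| <= M.
  have cn : {within `[a, b], continuous (fun t => `|x t 0 i|)}.
    apply/subspace_continuousP => t tab; apply: cvg_norm.
    by move/subspace_continuousP: (@abs_continuous_within _ _ _ _ _ i acx); exact.
  by have [c _ maxc] := EVT_max ab cn; exists `|x c 0 i|.
have [M Mx] := choice bnd; exists (\sum_i M i) => t i tab.
rewrite (le_trans (Mx i t tab))// (bigD1 i)//= lerDl.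
by apply: sumr_ge0 => j _; exact: le_trans (Mx j t tab).
Qed.

(** A single algebraic condition that says that f is differentiable with
    derivative f', and that f' is Lipschitz.  It is stable under linear
    combinations, and easy to check for piecewise quadratic functions. *)
Definition quad_approx (R : realType) (K : R) (f f' : R -> R) : Prop :=
  forall x y, `|f y - f x - f' x * (y - x)| <= K * (y - x) ^+ 2.

Lemma quad_approx_ge0 (R : realType) (K : R) (f f' : R -> R) :
  quad_approx K f f' -> 0 <= K.
Proof.
by move=> /(_ 0 1); rewrite subr0 expr1n !mulr1; apply: le_trans.
Qed.

Lemma quad_approx_sqr (R : realType) :
  quad_approx 1 (fun x : R => x ^+ 2) (fun x => 2 * x).
Proof.
move=> x y; rewrite (_ : _ - _ - _ = (y - x) ^+ 2); last by ring.
by rewrite mul1r ger0_norm// sqr_ge0.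
Qed.

Lemma quad_approx_lin (R : realType) (K L s t : R) (f f' g g' : R -> R) :
  quad_approx K f f' -> quad_approx L g g' ->
  quad_approx (`|s| * K + `|t| * L) (fun x => s * f x + t * g x)
    (fun x => s * f' x + t * g' x).
Proof.
move=> fK gL x y.
rewrite (_ : _ - _ - _ = s * (f y - f x - f' x * (y - x)) +
  t * (g y - g x - g' x * (y - x))); last by ring.
rewrite (le_trans (ler_normD _ _))// mulrDl !normrM -!mulrA.
by rewrite lerD// ler_wpM2l.
Qed.

(** Add the two expansions, of f y at x and of f x at y. *)
Lemma quad_approx_derive_lip (R : realType) (K : R) (f f' : R -> R) :
  quad_approx K f f' -> forall x y, `|f' y - f' x| <= 2 * K * `|y - x|.
Proof.
move=> fK x y; have [->|yx] := eqVneq y x; first by rewrite !subrr !normr0 mulr0.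
have yx0 : 0 < `|y - x| by rewrite normr_gt0 subr_eq0.
rewrite -(ler_pM2r yx0) -normrM.
rewrite [leRHS](_ : _ = 2 * K * (y - x) ^+ 2); last first.
  by rewrite -[LHS]mulrA -expr2 real_normK ?num_real.
rewrite (_ : (f' y - f' x) * (y - x) = (f y - f x - f' x * (y - x)) +
  (f x - f y - f' y * (x - y))); last by ring.
rewrite (le_trans (ler_normD _ _))//.
by have := fK x y; have := fK y x; rewrite -(opprB y x) sqrrN; lra.
Qed.

Lemma quad_approx_is_derive (R : realType) (K : R) (f f' : R -> R) (x : R) :
  quad_approx K f f' -> is_derive x 1 f (f' x).
Proof.
move=> fK; have K0 := quad_approx_ge0 fK.
have lim : h^-1 *: ((f \o shift x) (h *: 1) - f x) @[h --> 0^'] --> f' x.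
  apply/cvgrPdist_le => e e0; near=> h.
  have h0 : h != 0 by near: h; exact: nbhs_dnbhs_neq.
  have hn0 : 0 < `|h| by rewrite normr_gt0.
  rewrite -(ler_pM2r hn0) -normrM /= [h *: 1](mulr1) mulrBl mulrAC mulVf// mul1r.
  rewrite distrC; have := fK x (h + x); rewrite addrK => /le_trans; apply.
  rewrite -real_normK ?num_real// expr2 mulrA ler_wpM2r//.
  rewrite (@le_trans _ _ ((K + 1) * `|h|))// ?ler_wpM2r ?lerDl//.
  rewrite mulrC -ler_pdivlMr ?ltr_wpDl//.
  by apply/ltW; near: h; apply: dnbhs0_lt; rewrite divr_gt0// ltr_wpDl.
by split; [apply/cvg_ex; exists (f' x) | apply/cvg_lim].
Unshelve. all: by end_near. Qed.

Lemma quad_approx_local_lip (R : realType) (K M : R) (f f' : R -> R) :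
  quad_approx K f f' -> exists2 L : R, 0 <= L &
  forall x y, `|x| <= M -> `|y| <= M -> `|f y - f x| <= L * `|y - x|.
Proof.
move=> fK; have K0 := quad_approx_ge0 fK.
exists (`|f' 0| + 4 * K * `|M|).
  by rewrite addr_ge0// !mulr_ge0.
move=> x y xM yM; have MM := ler_norm M.
have f'x : `|f' x| <= `|f' 0| + 2 * K * `|M|.
  rewrite -lerBlDl (le_trans (lerB_dist _ _))//.
  rewrite (le_trans (quad_approx_derive_lip fK _ _))// subr0.
  by rewrite ler_wpM2l ?mulr_ge0// (le_trans xM).
have yx2 : K * (y - x) ^+ 2 <= 2 * K * `|M| * `|y - x|.
  rewrite -real_normK ?num_real// expr2 mulrA ler_wpM2r// mulrAC mulrC ler_wpM2r//.
  by rewrite (le_trans (ler_normB _ _))//; lra.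
rewrite (_ : f y - f x = (f y - f x - f' x * (y - x)) + f' x * (y - x)); last first.
  by ring.
rewrite (le_trans (ler_normD _ _))// normrM.
have := fK x y; have := ler_wpM2r (normr_ge0 (y - x)) f'x.
lra.
Qed.

Lemma abs_continuous_sum_comp (R : realType) (N : nat) (a b K : R)
    (x : R -> 'rV[R]_N) (f f' : R -> R) :
  a <= b -> abs_continuous_on a b x -> quad_approx K f f' ->
  abs_continuous_real a b (fun t => \sum_i f (x t 0 i)).
Proof.
move=> ab acx fK; have [M xM] := abs_continuous_bounded ab acx.
have [L L0 fL] := quad_approx_local_lip M fK.
have NL0 : 0 < N%:R * L + 1 by rewrite ltr_wpDl// mulr_ge0.
move=> e e0; have [|d d0 acd] := acx (e / (N%:R * L + 1)); first exact: divr_gt0.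
exists d => // n u v uv triv len.
apply: (@le_lt_trans _ _ (\sum_(k < n) (N%:R * L + 1) * enorm (x (v k) - x (u k)))).
  apply: ler_sum => k _; have [au [uvk vb]] := uv k.
  rewrite -sumrB (le_trans (ler_norm_sum _ _ _))//.
  apply: (@le_trans _ _ (\sum_(i < N) L * enorm (x (v k) - x (u k)))).
    apply: ler_sum => i _; rewrite (le_trans (fL _ _ _ _))//.
    - by apply: xM; rewrite in_itv/= au (le_trans uvk).
    - by apply: xM; rewrite in_itv/= vb (le_trans au).
    - rewrite ler_wpM2l//.
      by have := enorm_coord (x (v k) - x (u k)) i; rewrite !mxE.
  rewrite sumr_const card_ord -[leLHS]mulr_natl mulrA ler_wpM2r ?lerDl//.
  exact: sqrtr_ge0.
by rewrite -mulr_sumr mulrC -ltr_pdivlMr//; exact: acd.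
Qed.

(** A bound on the weighted sums over the Krasovskii set bounds the derivative
    of t |-> sum of the f(x_i(t)) almost everywhere, by the chain rule. *)
Lemma krasovskii_solution_growth (R : realType) (N : nat)
    (g : 'rV[R]_N -> 'rV[R]_N) (I : interval R) (x : R -> 'rV[R]_N)
    (a b c K : R) (f f' : R -> R) :
  krasovskii_solution g I x -> a <= b -> [set` `[a, b]] `<=` [set` I] ->
  quad_approx K f f' ->
  (forall t v, t \in `[a, b] -> krasovskii g (x t) v ->
     \sum_i f' (x t 0 i) * v 0 i <= c) ->
  \sum_i f (x b 0 i) - \sum_i f (x a 0 i) <= c * (b - a).
Proof.
move=> [acx solx] ab abI fK fc.
apply: (abs_continuous_growth ab (abs_continuous_sum_comp ab (acx _ _ abI) fK)).
apply: negligibleS solx; apply: subsetC => t sol tab.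
have [dx kx] := sol (abI t tab).
exists (\sum_i f' (x t 0 i) * ('D_1 x t) 0 i); first exact: fc.
have dxi i : is_derive t 1 (fun s => x s 0 i) (('D_1 x t) 0 i).
  rewrite derive_mx// mxE; apply: derivableP.
  by move/derivable_mxP: dx.
have := @is_derive_sum _ _ _ _ (fun i s => f (x s 0 i)) t 1 _
  (fun i => is_derive1_comp (quad_approx_is_derive (x t 0 i) fK) (dxi i)).
rewrite (_ : \sum_(i < N) (fun s => f (x s 0 i)) =
  (fun s => \sum_i f (x s 0 i)))//.
by apply/funext => s; rewrite fct_sumE.
Qed.

(** * Dissipation of energy *)

Lemma influence_ge0 (R : realType) (z : R) : 0 <= influence z.
Proof. by rewrite /influence; case: ifP. Qed.

(** After symmetrization all the terms have the same sign, so one may keep a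
    single pair (p, q). *)
Lemma opinion_field_comonotone_le (R : realType) (N : nat) (w : 'I_N -> R)
    (x : 'rV[R]_N) (p q : 'I_N) :
  (forall i j, 0 <= (x 0 j - x 0 i) * (w j - w i)) ->
  (\sum_i w i * opinion_field x 0 i) *+ 2 <=
  - (influence (x 0 q - x 0 p) * ((x 0 q - x 0 p) * (w q - w p))).
Proof.
move=> wx; have term i j :
    0 <= influence (x 0 j - x 0 i) * ((x 0 j - x 0 i) * (w j - w i)).
  by rewrite mulr_ge0 ?influence_ge0.
rewrite opinion_field_weighted lerN2 (bigD1 p)//= (bigD1 q)//= -addrA lerDl.
by rewrite addr_ge0 ?sumr_ge0// => i _; exact: sumr_ge0.
Qed.

Lemma opinion_field_comonotone_le0 (R : realType) (N : nat) (w : 'I_N -> R)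
    (x : 'rV[R]_N) :
  (forall i j, 0 <= (x 0 j - x 0 i) * (w j - w i)) ->
  \sum_i w i * opinion_field x 0 i <= 0.
Proof.
case: N w x => [|n] w x wx; first by rewrite big_ord0.
by have := opinion_field_comonotone_le ord0 ord0 wx; rewrite subrr mul0r mulr0; lra.
Qed.

Lemma comonotone_double (R : realType) (N : nat) (x : 'rV[R]_N) (i j : 'I_N) :
  0 <= (x 0 j - x 0 i) * (2 * x 0 j - 2 * x 0 i).
Proof. by rewrite -mulrBr mulrCA mulr_ge0// -expr2 sqr_ge0. Qed.

(** The left-hand side is the derivative of the energy along v. *)
Lemma krasovskii_energy (R : realType) (N : nat) (x v : 'rV[R]_N) (p q : 'I_N) :
  krasovskii (@opinion_field R N) x v ->
  \sum_i 2 * x 0 i * v 0 i <=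
  - (influence (x 0 q - x 0 p) * (x 0 q - x 0 p) ^+ 2).
Proof.
move=> Kv; apply: le_trans (krasovskii_comonotone (@comonotone_double R N x) Kv) _.
by have := opinion_field_comonotone_le p q (@comonotone_double R N x); lra.
Qed.

Lemma complete_solution_itv (R : realType) (N : nat) (g : 'rV[R]_N -> 'rV[R]_N)
    (I : interval R) (x : R -> 'rV[R]_N) (a b : R) :
  complete_krasovskii_solution g I x -> 0 <= a ->
  [set` `[a, b]] `<=` [set` I].
Proof.
move=> [cI _] a0 t; rewrite /= in_itv/= => /andP[a_t _].
by apply: cI; exact: le_trans a_t.
Qed.

(** For e = 1 or e = -1, the derivative e f' + 2 K z of e f + K z^2 is
    nondecreasing, because f' is 2 K-Lipschitz.  Its values at the coordinates
    are therefore comonotone with them, and the sum of e f(x_i) + K x_i^2 does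
    not increase. *)
Lemma variation_le_energy_drop (R : realType) (N : nat) (I : interval R)
    (x : R -> 'rV[R]_N) (K s t : R) (f f' : R -> R) :
  complete_krasovskii_solution (@opinion_field R N) I x ->
  quad_approx K f f' -> 0 <= s -> s <= t ->
  `|\sum_i f (x t 0 i) - \sum_i f (x s 0 i)| <=
  K * (\sum_i x s 0 i ^+ 2 - \sum_i x t 0 i ^+ 2).
Proof.
move=> solx fK s0 st.
have signed (e : R) : `|e| = 1 ->
    e * (\sum_i f (x t 0 i) - \sum_i f (x s 0 i)) <=
    K * (\sum_i x s 0 i ^+ 2 - \sum_i x t 0 i ^+ 2).
  move=> e1.
  have feK := quad_approx_lin e K fK (@quad_approx_sqr R).
  have := krasovskii_solution_growth (c := 0) solx.2 st
    (complete_solution_itv solx s0) feK.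
  rewrite mul0r !big_split/= -!mulr_sumr => growth.
  suff : e * \sum_i f (x t 0 i) + K * \sum_i x t 0 i ^+ 2 -
    (e * \sum_i f (x s 0 i) + K * \sum_i x s 0 i ^+ 2) <= 0 by lra.
  apply: growth => r v _ Kv.
  have como i j : 0 <= (x r 0 j - x r 0 i) *
      ((e * f' (x r 0 j) + K * (2 * x r 0 j)) -
       (e * f' (x r 0 i) + K * (2 * x r 0 i))).
    set y := x r 0 j; set z := x r 0 i.
    rewrite (_ : _ * _ =
      e * (f' y - f' z) * (y - z) + 2 * K * (y - z) ^+ 2); last by ring.
    rewrite -lerBlDl sub0r.
    rewrite (le_trans (ler_norm _))// normrN !normrM e1 mul1r.
    rewrite -[in leRHS]real_normK ?num_real// [in leRHS]expr2 mulrA ler_wpM2r//.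
    exact: quad_approx_derive_lip.
  apply: le_trans (krasovskii_comonotone como Kv) _.
  exact: opinion_field_comonotone_le0.
rewrite ler_norml; apply/andP; split.
  by have := signed (-1); rewrite normrN normr1 => /(_ erefl); lra.
by have := signed 1; rewrite normr1 => /(_ erefl); lra.
Qed.

Lemma energy_nonincreasing (R : realType) (N : nat) (I : interval R)
    (x : R -> 'rV[R]_N) (s t : R) :
  complete_krasovskii_solution (@opinion_field R N) I x -> 0 <= s -> s <= t ->
  \sum_i x t 0 i ^+ 2 <= \sum_i x s 0 i ^+ 2.
Proof.
move=> solx s0 st; have := variation_le_energy_drop solx (@quad_approx_sqr R) s0 st.
by rewrite mul1r => /(le_trans (normr_ge0 _)); rewrite subr_ge0.
Qed.

Lemma energy_tail (R : realType) (N : nat) (I : interval R)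
    (x : R -> 'rV[R]_N) (e : R) :
  complete_krasovskii_solution (@opinion_field R N) I x -> 0 < e ->
  exists2 T : R, 0 <= T & forall t, T <= t ->
    \sum_i x T 0 i ^+ 2 - \sum_i x t 0 i ^+ 2 < e.
Proof.
move=> solx e0; pose E := [set \sum_i x t 0 i ^+ 2 | t in [set t : R | 0 <= t]].
have infE : has_inf E.
  split; first by exists (\sum_i x 0 0 i ^+ 2); exists 0 => //=.
  by exists 0 => _ [t _ <-]; apply: sumr_ge0 => i _; exact: sqr_ge0.
have [_ [T T0 <-] VT] := inf_adherent e0 infE.
exists T => // t Tt; rewrite ltrBlDr addrC (lt_le_trans VT)// lerD2r.
apply: ge_inf; first exact: infE.2.
by exists t => //=; exact: le_trans Tt.
Qed.

(** * Convergence of the coordinates *)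

(** The limit is the supremum of the eventual lower bounds of u. *)
Lemma cvg_no_oscillation (R : realType) (u : R -> R) (M : R) :
  (forall t, 0 <= t -> `|u t| <= M) ->
  (forall p q, p < q -> exists T : R,
     (forall t, T <= t -> p <= u t) \/ (forall t, T <= t -> u t <= q)) ->
  exists l : R, u t @[t --> +oo] --> l.
Proof.
move=> uM osc; pose A := [set c | exists T, forall t, T <= t -> c <= u t].
have A0 : A (- M).
  by exists 0 => t t0; have := uM t t0; rewrite ler_norml => /andP[].
have ubA : ubound A M.
  move=> c [T Tc]; apply: (@le_trans _ _ (u (Num.max T 0))).
    by apply: Tc; rewrite le_max lexx.
  by rewrite (le_trans (ler_norm _))// uM// le_max lexx orbT.
have supA : has_sup A by split; [exists (- M) | exists M].
exists (sup A); apply/cvgrPdist_le => e e0.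
have [c [T Tc] cA] := sup_adherent e0 supA.
have [|T' [lo|hi]] := osc (sup A + e / 2) (sup A + e); first lra.
  have : A (sup A + e / 2) by exists T'.
  move=> /(ub_le_sup supA.2) {}lo; lra.
near=> t; rewrite distrC ler_norml; apply/andP; split.
  have : c <= u t by apply: Tc; near: t; apply: nbhs_pinfty_ge; rewrite num_real.
  lra.
have : u t <= sup A + e.
  by apply: hi; near: t; apply: nbhs_pinfty_ge; rewrite num_real.
lra.
Unshelve. all: by end_near. Qed.

Definition ramp_sqr (R : realType) (z : R) : R := Num.max z 0 ^+ 2.

Lemma quad_approx_ramp_sqr (R : realType) (m : R) :
  quad_approx 1 (fun x => ramp_sqr (x - m)) (fun x => 2 * Num.max (x - m) 0).
Proof.
move=> x y; rewrite /ramp_sqr mul1r.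
have -> : y - x = (y - m) - (x - m) by lra.
move: (x - m) (y - m) => {}x {}y.
have := sqr_ge0 (y - x); rewrite ler_norml.
by case: (leP x 0) => x0; case: (leP y 0) => y0 ?; apply/andP; split; nra.
Qed.

(** Up to a factor, the quadratic B-spline with nodes m, m + h, m + 2 h and
    m + 3 h: a bump that vanishes outside ]m, m + 3 h[ and whose derivative is
    Lipschitz, with a constant that does not depend on h. *)
Definition spline (R : realType) (m h x : R) : R :=
  ramp_sqr (x - m) - 3 * ramp_sqr (x - (m + h)) +
  3 * ramp_sqr (x - (m + 2 * h)) - ramp_sqr (x - (m + 3 * h)).

Lemma quad_approx_spline (R : realType) (m h : R) :
  exists f' : R -> R, quad_approx 8 (spline m h) f'.
Proof.
pose r k x : R := 2 * Num.max (x - (m + k * h)) 0.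
exists (fun x => r 0 x - 3 * r 1 x + 3 * r 2 x - r 3 x) => x y.
have := quad_approx_ramp_sqr (m + 0 * h) x y.
have := quad_approx_ramp_sqr (m + 1 * h) x y.
have := quad_approx_ramp_sqr (m + 2 * h) x y.
have := quad_approx_ramp_sqr (m + 3 * h) x y.
rewrite /spline /r !mul0r !addr0 !mul1r !ler_norml.
by do 4![move=> /andP[? ?]]; apply/andP; split; lra.
Qed.

Lemma spline_ge0 (R : realType) (m h x : R) : 0 < h -> 0 <= spline m h x.
Proof.
move=> h0; rewrite /spline /ramp_sqr.
case: (leP (x - m) 0) => ?; case: (leP (x - (m + h)) 0) => ?;
case: (leP (x - (m + 2 * h)) 0) => ?; case: (leP (x - (m + 3 * h)) 0) => ?; nra.
Qed.

Lemma spline_supp (R : realType) (m h x : R) : 0 < h ->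
  spline m h x != 0 -> m < x < m + 3 * h.
Proof.
move=> h0; apply: contraNT; rewrite negb_and -!leNgt /spline /ramp_sqr.
case/orP => xm.
  by rewrite !max_r; first apply/eqP; lra.
by rewrite !max_l; first apply/eqP; lra.
Qed.

Lemma spline_mid (R : realType) (m h : R) : 0 < h ->
  spline m h (m + 3 / 2 * h) = 3 / 2 * h ^+ 2.
Proof.
move=> h0; rewrite /spline /ramp_sqr.
rewrite (@max_l _ _ (_ - m)); last lra.
rewrite (@max_l _ _ (_ - (m + h))); last lra.
rewrite (@max_r _ _ (_ - (m + 2 * h))); last lra.
rewrite (@max_r _ _ (_ - (m + 3 * h))); last lra.
by field.
Qed.

(** Pigeonhole: if x_i went on oscillating across ]p, q[, then N + 1 disjoint
    subintervals would all be occupied, at the same time T, by only N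
    coordinates. *)
Lemma coordinate_cvg (R : realType) (N : nat) (I : interval R)
    (x : R -> 'rV[R]_N) (i : 'I_N) :
  complete_krasovskii_solution (@opinion_field R N) I x ->
  exists l : R, x t 0 i @[t --> +oo] --> l.
Proof.
move=> solx.
apply: (@cvg_no_oscillation _ _ (Num.sqrt (\sum_j x 0 0 j ^+ 2))) => [t t0|p q pq].
  apply: le_trans (enorm_coord (x t) i) _.
  by rewrite ler_wsqrtr// (energy_nonincreasing solx).
apply: contrapT => osc.
pose h := (q - p) / (3 * N.+1%:R).
have h0 : 0 < h by rewrite divr_gt0 ?subr_gt0// mulr_gt0.
have hN : 3 * h * N.+1%:R = q - p.
  by rewrite mulrAC -/h mulrC divfK// mulf_neq0// pnatr_eq0.
(* With the constant 8 of the splines, the sum of each spline varies after T by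
   less than its peak value 3/2 h^2. *)
have [T T0 VT] := energy_tail (e := 3 / 16 * h ^+ 2) solx ltac:(nra).
pose m (k : 'I_N.+1) := p + 3 * h * k%:R.
have visit (k : 'I_N.+1) : exists2 t, T <= t & x t 0 i = m k + 3 / 2 * h.
  have [t1 Tt1 xt1] : exists2 t, T <= t & x t 0 i < p.
    apply: contrapT => nlow; apply: osc; exists T; left => t Tt.
    by rewrite leNgt; apply/negP => xtp; apply: nlow; exists t.
  have [t2 t12 xt2] : exists2 t, t1 <= t & q < x t 0 i.
    apply: contrapT => nhigh; apply: osc; exists t1; right => t Tt.
    by rewrite leNgt; apply/negP => xtp; apply: nhigh; exists t.
  have t10 : 0 <= t1 by exact: le_trans Tt1.
  have cx := @abs_continuous_within _ _ _ _ _ i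
    (solx.2.1 _ _ (complete_solution_itv solx t10)).
  have [|t] := IVT t12 (cx t2) (v := m k + 3 / 2 * h).
    have k0 : 0 <= k%:R :> R by [].
    have kN : k%:R + 1 <= N.+1%:R :> R by rewrite natr1 ler_nat.
    rewrite ge_min le_max /m; apply/andP; split; apply/orP; [left|right]; nra.
  rewrite in_itv/= => /andP[t1t _] xt; exists t => //; exact: le_trans t1t.
have occupied (k : 'I_N.+1) : exists j : 'I_N, m k < x T 0 j < m k + 3 * h.
  have [t Tt xt] := visit k; have [f' fK] := quad_approx_spline (m k) h.
  have mid : 3 / 2 * h ^+ 2 <= \sum_j spline (m k) h (x t 0 j).
    rewrite (bigD1 i)//= xt spline_mid// lerDl.
    by apply: sumr_ge0 => j _; exact: spline_ge0.
  have var := variation_le_energy_drop solx fK T0 Tt.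
  have pos : 0 < \sum_j spline (m k) h (x T 0 j).
    by have := VT t Tt; move: var; rewrite ler_norml => /andP[? ?] ?; lra.
  apply: contrapT => none; move: pos; rewrite big1 ?ltxx// => j _.
  apply/eqP; apply: contrapT => /negP sj; apply: none; exists j.
  exact: spline_supp sj.
have [sg sgP] := choice occupied.
have sg_inj : injective sg.
  suff lt_neq (k l : 'I_N.+1) : (k < l)%N -> sg k <> sg l.
    move=> k l skl; case: (ltngtP k l) => [/lt_neq //|/lt_neq lk|/val_inj//].
    by case: lk.
  move=> kl skl; have := sgP k; have := sgP l.
  rewrite skl => /andP[lo _] /andP[_ hi].
  have : k%:R + 1 <= l%:R :> R by rewrite natr1 ler_nat.
  by move: lo hi; rewrite /m; nra.
by have := leq_card sg sg_inj; rewrite !card_ord ltnn.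
Qed.

(** Two limits at distance r in ]0, 1[ keep a pair interacting at distance at
    least r / 2 forever, which costs (r / 2)^2 of energy per unit of time. *)
Lemma limit_clustered (R : realType) (N : nat) (I : interval R)
    (x : R -> 'rV[R]_N) (xs : 'rV[R]_N) :
  complete_krasovskii_solution (@opinion_field R N) I x ->
  (forall i, x t 0 i @[t --> +oo] --> xs 0 i) -> clustered xs.
Proof.
move=> solx xcvg p q; apply: contrapT => /not_orP[/eqP pq /negP].
rewrite -ltNge; set r := `|_| => r1.
have r0 : 0 < r by rewrite normr_gt0 subr_eq0.
have dcvg : `|x t 0 q - x t 0 p| @[t --> +oo] --> r.
  by rewrite /r distrC; apply: cvg_norm; apply: cvgB.
have [T [T0 close]] : exists T : R, 0 <= T /\
    forall t, T <= t -> r / 2 < `|x t 0 q - x t 0 p| < 1.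
  have : \forall t \near +oo, r / 2 < `|x t 0 q - x t 0 p| < 1.
    near=> t; apply/andP; split; near: t.
      by apply: cvgr_gt dcvg _ _; lra.
    exact: cvgr_lt dcvg _ r1.
  move=> [A [_ Anear]]; exists (Num.max 0 (A + 1)).
  rewrite le_max lexx; split=> // t.
  by rewrite ge_max => /andP[_ At]; apply: Anear; lra.
pose VT := \sum_i x T 0 i ^+ 2.
have VT0 : 0 <= VT by apply: sumr_ge0 => i _; exact: sqr_ge0.
pose c := (r / 2) ^+ 2.
have c0 : 0 < c by rewrite exprn_gt0// divr_gt0.
(* A time long enough to dissipate VT + 1, more than the energy available. *)
pose s := T + (VT + 1) / c.
have Ts : T <= s by rewrite lerDl divr_ge0// ?ltW//; lra.
have := krasovskii_solution_growth (c := - c) solx.2 Ts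
  (complete_solution_itv solx T0) (@quad_approx_sqr R).
have -> : s - T = (VT + 1) / c by rewrite /s addrAC subrr add0r.
rewrite -/VT mulNr mulrC divfK ?gt_eqF//.
suff rate : forall t v, t \in `[T, s] -> krasovskii (@opinion_field R N) (x t) v ->
    \sum_i 2 * x t 0 i * v 0 i <= - c.
  move=> /(_ rate); have : 0 <= \sum_i x s 0 i ^+ 2.
    by apply: sumr_ge0 => i _; exact: sqr_ge0.
  lra.
move=> t v; rewrite in_itv/= => /andP[Tt _] Kv.
apply: le_trans (krasovskii_energy p q Kv) _.
have /andP[lo hi] := close t Tt.
rewrite /influence hi mul1r lerN2 -[leRHS]real_normK ?num_real// /c.
by move: lo; set y := `|_| => ?; nra.
Unshelve. all: by end_near. Qed.

(** * Equilibria *)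

Lemma clustered_field_eq0 (R : realType) (N : nat) (x : 'rV[R]_N) :
  clustered x -> opinion_field x = 0.
Proof.
move=> cx; apply/rowP => i; rewrite !mxE big1// => j _.
have [->|ji] := cx j i; first by rewrite subrr mulr0.
by rewrite /influence ltNge ji mul0r.
Qed.

Lemma field_in_krasovskii (R : realType) (N : nat)
    (g : 'rV[R]_N -> 'rV[R]_N) (x : 'rV[R]_N) : krasovskii g x (g x).
Proof.
move=> d d0; apply: subset_closure; apply: sub_gen_smallest; exists x => //=.
rewrite /enorm big1 ?sqrtr0// => i _.
by rewrite !mxE subrr expr0n.
Qed.

(** The velocity of a constant map is 0 at every time; the condition almost
    everywhere is equivalent to the condition at one time since [0, 1] is not a
    null set. *)
Lemma krasovskii_equilibriumE (R : realType) (N : nat)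
    (g : 'rV[R]_N -> 'rV[R]_N) (x : 'rV[R]_N) :
  krasovskii_equilibrium g x <-> krasovskii g x 0.
Proof.
split=> [[_ [M [mM M0 badM]]]|Kx0].
  apply: contrapT => nK.
  have : [set` `[0, 1]] `<=` M.
    move=> t; rewrite /= in_itv/= => /andP[t0 _]; apply: badM => /= sol.
    have [|_] := sol; first by rewrite in_itv/= t0.
    by rewrite derive_cst.
  have mI : measurable [set` `[0 : R, 1]] by [].
  move=> /(le_measure (@lebesgue_measure R)); rewrite !inE => /(_ mI mM).
  rewrite [X in (_ <= X)%E]M0 /= lebesgue_measure_itv/= lte_fin ltr01 -EFinB.
  by rewrite subr0 lee_fin ler10.
split.
  move=> a b _ e e0; exists 1 => // n u v _ _ _; rewrite big1// => k _.
  by rewrite subrr /enorm big1 ?sqrtr0// => i _; rewrite mxE expr0n.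
apply: aeW => t _; split; first exact: derivable_cst.
by rewrite derive_cst.
Qed.

Theorem theorem2 (R : realType) (N : nat) (hN : (1 <= N)%N) :
  [set x : 'rV[R]_N | krasovskii_equilibrium (@opinion_field R N) x]
    = @clustered R N /\
  forall (I : interval R) (x : R -> 'rV[R]_N),
    complete_krasovskii_solution (@opinion_field R N) I x ->
    exists2 xs : 'rV[R]_N, @clustered R N xs & x t @[t --> +oo] --> xs.
Proof.
split.
  apply/seteqP; split=> x /=; rewrite krasovskii_equilibriumE.
    move=> Kx0 p q; apply: contrapT => /not_orP[/eqP pq /negP].
    rewrite -ltNge distrC => close.
    have := krasovskii_energy p q Kx0.
    rewrite big1 => [|i _]; last by rewrite mxE mulr0.
    rewrite /influence close mul1r oppr_ge0 => le0.
    have /eqP : (x 0 q - x 0 p) ^+ 2 = 0 by apply/eqP; rewrite eq_le le0 sqr_ge0.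
    by rewrite sqrf_eq0 subr_eq0 eq_sym (negbTE pq).
  by move=> /clustered_field_eq0 <-; exact: field_in_krasovskii.
move=> I x solx.
have [l xl] := choice (fun i => coordinate_cvg i solx).
pose xs : 'rV[R]_N := \row_i l i.
have xcvg i : x t 0 i @[t --> +oo] --> xs 0 i by rewrite mxE.
exists xs; first exact: limit_clustered solx xcvg.
apply/cvgrPdist_le => e e0.
have all_close : \forall t \near +oo, forall i, `|xs 0 i - x t 0 i| <= e.
  by apply: filter_forall => i; move/cvgrPdist_le : (xcvg i); exact.
apply: filterS all_close => t xt.
rewrite /Num.Def.normr/= mx_normrE (bigmax_le _ (ltW e0))//= => -[j i] _.
by rewrite ord1 !mxE; have := xt i; rewrite mxE.
Qed.
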